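(* Assume the setting below and sharp missingness: $M_i(1)=M_i(0)$ for all $i$. Then: (i) for every $1\le k\le n_{\mathcal S1}$ and $c\in\mathbb R$, $p_{\texttt t,k,c,\mathcal S}$ is a valid p-value for $H^{\texttt{to}}_{k,c}:\sum_{i\in\mathcal S}Z_i\mathbf 1\{\tau_i>c\}\le n_{\mathcal S1}-k$ (equivalently $\tau_{\texttt{to}(k)}\le c$), i.e. $\mathbb P(p_{\texttt t,k,c,\mathcal S}\le\alpha\text{ and }H^{\texttt{to}}_{k,c}\text{ holds})\le\alpha$ for all $\alpha\in(0,1)$; (ii) for every $1\le k\le n_{\mathcal S1}$, $\mathcal I^\alpha_{\texttt{to},k}:=\{c\in\mathbb R:p_{\texttt t,k,c,\mathcal S}>\alpha\}$ is a $1-\alpha$ prediction interval for $\tau_{\texttt{to}(k)}$, and it is a one-sided interval of the form $[\hat\tau_{\texttt{to}(k)},\infty)$ or $(\hat\tau_{\texttt{to}(k)},\infty)$ with $\hat\tau_{\texttt{to}(k)}=\inf\mathcal I^\alpha_{\texttt{to},k}$; (iii) these are simultaneously valid: $\mathbb P(\tau_{\texttt{to}(k)}\in\mathcal I^\alpha_{\texttt{to},k}\text{ for all }1\le k\le n_{\mathcal S1})\ge1-\alpha$.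
   Context: There are $n$ units with fixed potential outcomes $Y_i^\star(0),Y_i^\star(1)\in\mathbb R$ and fixed potential missingness indicators $M_i(0),M_i(1)\in\{0,1\}$; $\tau_i=Y_i^\star(1)-Y_i^\star(0)$. $\boldsymbol Z\in\{0,1\}^n$ is from a completely randomized experiment: uniform over vectors with exactly $n_1$ ones ($n_1,n_0\ge1$ fixed, $n_1+n_0=n$), independent of all potential quantities. $M_i=Z_iM_i(1)+(1-Z_i)M_i(0)$; the realized outcome $Z_iY_i^\star(1)+(1-Z_i)Y_i^\star(0)$ is observed, denoted $Y_i$, iff $M_i=1$. $\mathcal S=\{i:M_i=1\}$, $n_{\mathcal S1}=\sum_{i\in\mathcal S}Z_i$, $n_{\mathcal S0}=|\mathcal S|-n_{\mathcal S1}$; $\tau_{\texttt{to}(1)}\le\dots\le\tau_{\texttt{to}(n_{\mathcal S1})}$ are the sorted $\tau_i$ over $i\in\mathcal S$ with $Z_i=1$. A $1-\alpha$ prediction interval $\mathcal I$ for a random quantity $\theta$ means $\mathbb P(\theta\in\mathcal I)\ge1-\alpha$. Statistics: $\overline{\mathbb R}=\mathbb R\cup\{\pm\infty\}$; $\psi_{i,j}(y,y')=\mathbf 1\{y>y'\}+\mathbf 1\{y=y'\}\mathbf 1\{i\ge j\}$; $\mathrm{rank}_i(\boldsymbol y)=\sum_j\psi_{i,j}(y_i,y_j)$; $\phi$ nondecreasing real function on nonnegative integers; $t_{\mathrm R,\phi}(\boldsymbol z,\boldsymbol y)$ is either $\sum_iz_i\phi(\mathrm{rank}_i(\boldsymbol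 y))$ or $\sum_iz_i\phi(\sum_j(1-z_j)\psi_{i,j}(y_i,y_j))$ (either choice). $t_{\mathrm R,\phi,\mathcal S}(\boldsymbol z,\boldsymbol y)=t_{\mathrm R,\phi}(\boldsymbol z_{\mathcal S},\boldsymbol y_{\mathcal S})$ (subvectors indexed by $\mathcal S$, original order); $G_{\mathrm R,\phi,\mathcal S}(c)=\mathbb P(t_{\mathrm R,\phi,\mathcal S}(\boldsymbol A,\boldsymbol y_0)\ge c)$ with $\boldsymbol A_{\mathcal S}$ uniform over assignments of $\mathcal S$ with exactly $n_{\mathcal S1}$ treated and $\boldsymbol y_0\in\mathbb R^n$ fixed. p-value: write $\{i:Z_i=M_i=1\}=\{j_1,\dots,j_{n_{\mathcal S1}}\}$ with $\psi_{j_{l+1},j_l}(Y_{j_{l+1}},Y_{j_l})=1$; $\mathcal J_L=\{j_{n_{\mathcal S1}-L+1},\dots,j_{n_{\mathcal S1}}\}$ for $L\ge1$, $\mathcal J_0=\emptyset$. Let $\boldsymbol v\in\overline{\mathbb R}^n$ with $v_i=-\infty$ for $i\in\mathcal J_{n_{\mathcal S1}-k}$ and $v_i=Y_i-cZ_i$ for other $i\in\mathcal S$ (coordinates outside $\mathcal S$ are unused). Then $p_{\texttt t,k,c,\mathcal S}=G_{\mathrm R,\phi,\mathcal S}(t_{\mathrm R,\phi,\mathcal S}(\boldsymbol Z,\boldsymbol v))$. *)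

(* Defs.v *)
From HB Require Import structures.
From mathcomp Require Import all_boot all_order all_algebra.
From mathcomp Require Import boolp classical_sets reals constructive_ereal ereal.
Set Implicit Arguments. Unset Strict Implicit. Unset Printing Implicit Defensive.
Import Order.TTheory GRing.Theory Num.Theory.
Local Open Scope ring_scope.

(* Units are 'I_n.  A treatment assignment z is encoded as the set of treated
   units: Z_i = 1  <->  i \in z. *)

Section Defs.
Variable R : realType.
Variable n : nat.

Definition cre_prob (n1 : nat) (E : {set 'I_n} -> bool) : R :=
  (#|[set z : {set 'I_n} | (#|z| == n1) && E z]|)%:R / ('C(n, n1))%:R.

Definition psi (i j : 'I_n) (y y' : \bar R) : bool :=
  ((y' < y)%E || ((y == y') && (j <= i)%N)).

(* t_{R,phi,S}(z,y) = t_{R,phi}(z_S, y_S).  Since the subvectors keep the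
   original order of indices, psi on the subvector is psi with the original
   indices.  [choice = true]: sum_i z_i phi(rank_i(y_S));
   [choice = false]: sum_i z_i phi(sum_j (1-z_j) psi_{i,j}(y_i,y_j)). *)
Definition tstat (choice : bool) (phi : nat -> R) (S z : {set 'I_n})
    (y : 'I_n -> \bar R) : R :=
  \sum_(i in S | i \in z)
     phi (if choice then #|[set j in S | psi i j (y i) (y j)]|
          else #|[set j in S | (j \notin z) && psi i j (y i) (y j)]|).

Definition Gfun (choice : bool) (phi : nat -> R) (S : {set 'I_n}) (nS1 : nat)
    (y0 : 'I_n -> R) (c : R) : R :=
  (#|[set A in powerset S | (#|A| == nS1) &&
        (c <= tstat choice phi S A (fun i => (y0 i)%:E))]|)%:R
  / ('C(#|S|, nS1))%:R.

Variables (Y1 Y0 : 'I_n -> R) (M1 M0 : 'I_n -> bool).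

Definition tau (i : 'I_n) : R := Y1 i - Y0 i.

Definition Mobs (z : {set 'I_n}) (i : 'I_n) : bool :=
  if i \in z then M1 i else M0 i.
Definition Sset (z : {set 'I_n}) : {set 'I_n} := [set i | Mobs z i].
(* realized outcome (observed iff i \in Sset z) *)
Definition Yobs (z : {set 'I_n}) (i : 'I_n) : R :=
  if i \in z then Y1 i else Y0 i.
Definition Tset (z : {set 'I_n}) : {set 'I_n} := Sset z :&: z.
Definition nS1 (z : {set 'I_n}) : nat := #|Tset z|.

(* j_1,...,j_{nS1} is the increasing ordering of Tset z w.r.t. psi; the
   position of i is its rank #{j in Tset z : psi_{i,j}(Y_i,Y_j)}.  J_L is the
   set of the top L of them, i.e. those of position > nS1 - L. *)
Definition Jset (z : {set 'I_n}) (L : nat) : {set 'I_n} :=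
  [set i in Tset z | (nS1 z - L <
     #|[set j in Tset z | psi i j (Yobs z i)%:E (Yobs z j)%:E]|)%N].

Definition vvec (z : {set 'I_n}) (k : nat) (c : R) (i : 'I_n) : \bar R :=
  if i \in Jset z (nS1 z - k) then -oo%E
  else ((Yobs z i - (if i \in z then c else 0))%R)%:E.

Definition pval (choice : bool) (phi : nat -> R) (y0 : 'I_n -> R)
    (z : {set 'I_n}) (k : nat) (c : R) : R :=
  Gfun choice phi (Sset z) (nS1 z) y0
       (tstat choice phi (Sset z) z (vvec z k c)).

(* H^{to}_{k,c}: sum_{i in S} Z_i 1{tau_i > c} <= nS1 - k  (k <= nS1 included) *)
Definition Hto (z : {set 'I_n}) (k : nat) (c : R) : bool :=
  (k + #|[set i in Tset z | (c < tau i)%R]| <= nS1 z)%N.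

Definition tau_to (z : {set 'I_n}) (k : nat) : R :=
  nth 0 (sort <=%R [seq tau i | i <- enum (Tset z)]) k.-1.

Definition Ito (choice : bool) (phi : nat -> R) (y0 : 'I_n -> R)
    (alpha : R) (z : {set 'I_n}) (k : nat) : set R :=
  [set c : R | alpha < pval choice phi y0 z k c].

End Defs.

(* Main.v *)
(* Under sharp missingness the observed set S does not depend on the assignment,
   and given the treated units outside S the treated units inside S form a
   uniform subset of S of fixed size.  A rank statistic with ties broken by index
   is distribution free, so the oracle p-value, which compares t(Z, Y(0)) with
   its randomization distribution, is valid.  When at most n_S1 - k treated
   effects exceed c, the l-th smallest treated coordinate of v is at most that of
   Y(0) for every l, and the controls agree; matching treated units by rank gives
   t(Z, v) <= t(Z, Y(0)), so p_{t,k,c,S} is at least the oracle p-value.  The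
   oracle p-value does not depend on (k, c): the single event that it exceeds
   alpha therefore implies coverage simultaneously for all k. *)
From mathcomp Require Import perm.
Require Import Defs.
From HB Require Import structures.
From mathcomp Require Import all_boot all_order all_algebra.
From mathcomp Require Import boolp classical_sets reals constructive_ereal ereal.
Import Order.TTheory GRing.Theory Num.Theory.
Local Open Scope ring_scope.
Set Implicit Arguments.
Unset Strict Implicit.
Unset Printing Implicit Defensive.

(** * Ranks within a finite set *)

Definition rank_in d (D : orderType d) (T : finType) (f : T -> D) (S : {set T})
    (i : T) : nat := #|[set j in S | (f j <= f i)%O]|.

Lemma rank_in_le d (D : orderType d) (T : finType) (f : T -> D) (S : {set T})
    (i j : T) : i \in S -> (rank_in f S i <= rank_in f S j)%N = (f i <= f j)%O.
Proof.
move=> iS; case: (leP (f i) (f j)) => [fij|fji].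
  apply/subset_leq_card/fintype.subsetP=> l; rewrite !inE => /andP[-> fl] /=.
  exact: le_trans fl fij.
apply/negbTE; rewrite -ltnNge; apply/proper_card/properP; split.
  apply/fintype.subsetP=> l; rewrite !inE => /andP[-> fl] /=.
  exact: le_trans fl (ltW fji).
by exists i; rewrite !inE iS //= -ltNge.
Qed.

Lemma rank_in_inj d (D : orderType d) (T : finType) (f : T -> D) (S : {set T}) :
  injective f -> {in S &, injective (rank_in f S)}.
Proof.
move=> f_inj i j iS jS eq_r; apply: f_inj; apply/le_anti.
by rewrite -(rank_in_le f j iS) -(rank_in_le f i jS) eq_r leqnn.
Qed.

Lemma rank_in_gt0 d (D : orderType d) (T : finType) (f : T -> D) (S : {set T})
    (i : T) : i \in S -> (0 < rank_in f S i)%N.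
Proof. by move=> iS; apply/card_gt0P; exists i; rewrite !inE iS /=. Qed.

Lemma rank_in_max d (D : orderType d) (T : finType) (f : T -> D) (S : {set T})
    (i : T) : (rank_in f S i <= #|S|)%N.
Proof.
by apply/subset_leq_card/fintype.subsetP=> j; rewrite inE => /andP[].
Qed.

(** Injectivity gives [#|S|] distinct ranks, all between 1 and [#|S|], so counting forces them to
    fill that range. *)
Lemma rank_in_image d (D : orderType d) (T : finType) (f : T -> D)
    (S : {set T}) : injective f ->
  [set (inord (rank_in f S i) : 'I_#|S|.+1) | i in S] = [set~ ord0].
Proof.
move=> f_inj; apply/eqP; rewrite eqEcard; apply/andP; split.
  apply/fintype.subsetP=> _ /imsetP[i iS ->]; rewrite !inE -val_eqE /= inordK.
    by rewrite -lt0n rank_in_gt0.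
  by rewrite ltnS rank_in_max.
rewrite cardsC1 card_ord card_in_imset // => i j iS jS /(congr1 val) /=.
rewrite !inordK ?ltnS ?rank_in_max //; exact: rank_in_inj.
Qed.

Lemma rank_in_surj d (D : orderType d) (T : finType) (f : T -> D)
    (S : {set T}) (r : nat) : injective f -> (0 < r <= #|S|)%N ->
  exists2 i, i \in S & rank_in f S i = r.
Proof.
move=> f_inj /andP[r0 rS].
have : (inord r : 'I_#|S|.+1) \in [set~ ord0].
  by rewrite !inE -val_eqE /= inordK // -lt0n.
rewrite -(rank_in_image S f_inj) => /imsetP[i iS /(congr1 val) /=].
by rewrite !inordK ?ltnS ?rank_in_max // => ->; exists i.
Qed.

(** Each point of [S] goes to the one of equal rank and all others stay fixed; a permutation of the
    whole of [T] can reindex sums. *)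
Lemma rank_in_match d (D : orderType d) (T : finType) (f g : T -> D)
    (S : {set T}) : injective f -> injective g ->
  exists s : {perm T}, (forall i, (s i \in S) = (i \in S)) /\
    {in S, forall i, rank_in f S (s i) = rank_in g S i}.
Proof.
move=> f_inj g_inj.
have ex i : exists j, (j \in S) = (i \in S) /\
    if i \in S then rank_in f S j = rank_in g S i else j = i.
  case iS: (i \in S); last by exists i.
  have [|j jS rj] := @rank_in_surj _ _ _ f S (rank_in g S i) f_inj.
    by rewrite rank_in_gt0 // rank_in_max.
  by exists j.
have [h hP] := choice ex.
have h_inj : injective h.
  move=> i j hij; have [Si Ri] := hP i; have [Sj Rj] := hP j.
  move: Ri Rj; rewrite -Si -Sj hij; case: ifP => hS; last by move=> <-.
  by move=> ->; apply: (rank_in_inj g_inj); rewrite -?Si -?Sj ?hij.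
exists (perm h_inj); split=> i; rewrite permE; have [Si Ri] := hP i => //.
by move=> iS; rewrite iS in Ri.
Qed.

(** * Rank statistics: monotonicity and distribution freeness *)

(* For [i \in S] treated, ranking [i] in [S :\: z] counts the controls
   below it: [b] selects between the two forms of [tstat]. *)
Definition rank_stat (R : realType) d (D : orderType d) (T : finType)
    (b : bool) (phi : nat -> R) (S z : {set T}) (f : T -> D) : R :=
  \sum_(i in S | i \in z) phi (rank_in f (if b then S else S :\: z) i).

(** The last hypothesis puts the order statistics of [v] over treated units below those of [u].
    After matching by rank, the treated parts of the ranks agree and the control parts can only
    grow. *)
Lemma rank_stat_dominated (R : realType) d (D : orderType d) (T : finType)
    (b : bool) (phi : nat -> R) (S z : {set T}) (u v : T -> D) :
  {homo phi : a b / (a <= b)%N >-> a <= b} ->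
  injective u -> injective v ->
  {in S :\: z, u =1 v} ->
  {in S :&: z, forall i, (rank_in u (S :&: z) i <=
                  #|[set j in S :&: z | (v j <= u i)%O]|)%N} ->
  rank_stat b phi S z v <= rank_stat b phi S z u.
Proof.
move=> phi_mono u_inj v_inj uv dom.
have [s [sT rs]] := rank_in_match (S :&: z) u_inj v_inj.
have inT i : (i \in S) && (i \in z) = (i \in S :&: z) by rewrite inE.
rewrite /rank_stat (eq_bigl _ _ inT) [leRHS](eq_bigl _ _ inT).
rewrite [leRHS](reindex_inj (@perm_inj _ s)) /= [leRHS](eq_bigl _ _ sT).
apply: ler_sum => i iT; apply: phi_mono.
(* Otherwise the units with [v j <= u (s i)] would be those with [v j <= v i] minus at least [i]:
   fewer than the common rank, against [dom]. *)
have vu : (v i <= u (s i))%O.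
  rewrite leNgt; apply/negP=> uv'.
  have := dom (s i); rewrite sT rs // => /(_ iT); apply/negP; rewrite -ltnNge.
  apply/proper_card/properP; split.
    apply/fintype.subsetP=> l; rewrite !inE => /andP[-> vl] /=.
    exact: le_trans vl (ltW uv').
  by exists i; rewrite ?inE -?inT in iT *; rewrite iT ?lexx //= -ltNge.
have ctl : (rank_in v (S :\: z) i <= rank_in u (S :\: z) (s i))%N.
  apply/subset_leq_card/fintype.subsetP=> j.
  rewrite !inE => /andP[jSz vji]; rewrite jSz /= uv ?inE //.
  exact: le_trans vji vu.
case: b => //.
have split_rank (w : T -> D) l :
    rank_in w S l = (rank_in w (S :&: z) l + rank_in w (S :\: z) l)%N.
  by rewrite /rank_in -(cardsID z); congr (_ + _)%N; apply: eq_card => j;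
    rewrite !inE; do !case: (_ \in _); rewrite ?andbF ?andbT.
by rewrite !split_rank rs // leq_add2l.
Qed.

(** The statistic depends on the order alone, so relabelling by rank transports it; a single [s]
    serves every assignment. *)
Lemma rank_stat_match (R : realType) d (D : orderType d) (T : finType)
    (b : bool) (phi : nat -> R) (S : {set T}) (f g : T -> D) :
  injective f -> injective g ->
  exists s : {perm T}, (forall i, (s i \in S) = (i \in S)) /\
    forall A : {set T}, rank_stat b phi S (s @: A) f = rank_stat b phi S A g.
Proof.
move=> f_inj g_inj; have [s [sS rs]] := rank_in_match S f_inj g_inj.
exists s; split=> // A; rewrite /rank_stat.
have sA i : (s i \in s @: A) = (i \in A).
  by rewrite mem_imset //; apply: perm_inj.
rewrite (reindex_inj (@perm_inj _ s)) /=.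
under eq_bigl do rewrite sS sA.
apply: eq_bigr => i /andP[iS _]; congr phi; case: b; first exact: rs.
rewrite /rank_in -[RHS](card_imset _ (@perm_inj _ s)); apply: eq_card => j.
have [l ->] : exists l, j = s l by exists (s^-1 j)%g; rewrite permKV.
rewrite [RHS]mem_imset; last exact: perm_inj.
rewrite !inE sS sA; case jS: (_ \in S); rewrite ?andbF //=; congr (_ && _).
by rewrite -(rank_in_le f _ (S := S)) ?sS // !rs // rank_in_le.
Qed.

Lemma card_subsets_rank_stat_ge (R : realType) d (D : orderType d)
    (T : finType) (b : bool) (phi : nat -> R) (S : {set T}) (f g : T -> D)
    (m : nat) (c : R) : injective f -> injective g ->
  (#|[set A in powerset S | (#|A| == m) && (c <= rank_stat b phi S A g)%R]| <=
   #|[set A in powerset S | (#|A| == m) && (c <= rank_stat b phi S A f)%R]|)%N.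
Proof.
move=> f_inj g_inj; have [s [sS st]] := rank_stat_match b phi S f_inj g_inj.
rewrite -(card_imset _ (imset_inj (@perm_inj _ s))).
apply/subset_leq_card/fintype.subsetP=> _ /imsetP[A + ->].
rewrite !inE st card_imset; last exact: perm_inj.
case/andP=> /fintype.subsetP AS -> /=; rewrite andbT.
by apply/fintype.subsetP=> _ /imsetP[i iA ->]; rewrite sS AS.
Qed.

(** The element of the event with the smallest [f] has the whole event in its upper tail, and that
    tail has proportion at most [a]. *)
Lemma card_upper_tail_le (R : realType) (T : finType) (O : {set T})
    (f : T -> R) (a : R) : 0 <= a ->
  #|[set x in O | #|[set y in O | f x <= f y]|%:R / #|O|%:R <= a]|%:R
    <= a * #|O|%:R.
Proof.
move=> a0; set E := [set x in O | _].
have [->|[x0 x0E]] := set_0Vmem E; first by rewrite cards0 mulr_ge0.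
case: (@arg_minP _ _ _ x0 (mem E) f x0E) => x xE xmin.
change (is_true (x \in E)) in xE.
have := xE; rewrite inE => /andP[xO].
rewrite ler_pdivrMr ?ltr0n; last by apply/card_gt0P; exists x.
apply: le_trans; rewrite ler_nat; apply/subset_leq_card/fintype.subsetP=> y yE.
by rewrite inE (xmin y yE) andbT; move: yE; rewrite inE => /andP[].
Qed.

(** * Extended outcomes with ties broken by index *)

(* Lexicographic comparison of these pairs is [psi], tie-breaking included. *)
Definition key (R : realType) n (y : 'I_n -> \bar R) (i : 'I_n)
  : (\bar R *l 'I_n)%type := (y i, i).

Lemma key_inj (R : realType) n (y : 'I_n -> \bar R) : injective (key y).
Proof. by move=> i j []. Qed.

Lemma psi_key (R : realType) n (y y' : 'I_n -> \bar R) (i j : 'I_n) :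
  psi i j (y i) (y' j) = (key y' j <= key y i)%O.
Proof.
by rewrite /psi /key lexi_pair; case: (ltgtP (y' j) (y i)).
Qed.

Lemma key_le (R : realType) n (y y' : 'I_n -> \bar R) (i : 'I_n) :
  (y i <= y' i)%E -> (key y i <= key y' i)%O.
Proof. by move=> h; rewrite /key lexi_pair h lexx implybT. Qed.

Lemma tstat_key (R : realType) n (b : bool) (phi : nat -> R)
    (S z : {set 'I_n}) (y : 'I_n -> \bar R) :
  tstat b phi S z y = rank_stat b phi S z (key y).
Proof.
apply: eq_bigr => i _; congr phi; case: b; apply: eq_card => j.
  by rewrite !inE psi_key.
by rewrite !inE psi_key andbCA andbA.
Qed.

Lemma rank_stat_setI (R : realType) d (D : orderType d) (T : finType)
    (b : bool) (phi : nat -> R) (S z : {set T}) (f : T -> D) :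
  rank_stat b phi S (S :&: z) f = rank_stat b phi S z f.
Proof.
rewrite /rank_stat finset.setDIr finset.setDv finset.set0U; apply: eq_bigl => i.
by rewrite inE andbA andbb.
Qed.

(** * Comparing the imputed vector with the control outcomes *)

Lemma card_rank_in_le d (D : orderType d) (T : finType) (f : T -> D)
    (S : {set T}) (k : nat) : (#|[set i in S | (rank_in f S i <= k)%N]| <= k)%N.
Proof.
set E := [set i in S | _].
have [->|[x0 x0E]] := set_0Vmem E; first by rewrite cards0.
case: (@arg_maxP _ _ _ x0 (mem E) f x0E) => x xE xmax.
change (is_true (x \in E)) in xE; have := xE; rewrite inE => /andP[xS].
apply: leq_trans; apply/subset_leq_card/fintype.subsetP=> y yE.
have yx : (f y <= f x)%O := xmax y yE.
by rewrite inE yx andbT; move: yE; rewrite inE => /andP[].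
Qed.

(** A down-set and a top segment that meet cover [S]; if they are disjoint, their sizes add. *)
Lemma card_downset_top d (D : orderType d) (T : finType) (f : T -> D)
    (S W : {set T}) (k : nat) :
  W \subset S ->
  {in S & W, forall i j, (f i <= f j)%O -> i \in W} ->
  (minn #|S| (#|W| + (#|S| - k)) <=
     #|W :|: [set i in S | (k < rank_in f S i)%N]|)%N.
Proof.
move=> WS Wdown; set J := [set i in S | _].
have cJ : (#|S| - k <= #|J|)%N.
  rewrite leq_subLR -(cardsID J S) addnC leq_add //.
    have <- : [set i in S | (rank_in f S i <= k)%N] = S :\: J.
      apply/finset.setP=> i; rewrite !inE; case: (_ \in S); rewrite ?andbF //=.
      by rewrite andbT -leqNgt.
    exact: card_rank_in_le.
  by apply/subset_leq_card; exact: finset.subsetIr.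
have [WJ0|[j]] := set_0Vmem (W :&: J).
  by rewrite geq_min cardsU WJ0 cards0 subn0 leq_add2l cJ orbT.
rewrite !inE => /andP[jW /andP[jS kj]].
rewrite geq_min; apply/orP; left; apply/subset_leq_card/fintype.subsetP=> i iS.
rewrite !inE iS /=; case iW: (i \in W) => //=; apply: leq_trans kj _.
rewrite rank_in_le //; case: (leP (f i) (f j)) => [fij|/ltW //].
by rewrite (Wdown i j) in iW.
Qed.

Lemma Gfun_anti (R : realType) n (b : bool) (phi : nat -> R) (S : {set 'I_n})
    (m : nat) (y0 : 'I_n -> R) : {homo Gfun b phi S m y0 : c c' /~ c <= c'}.
Proof.
move=> c c' cc'; rewrite ler_wpM2r ?invr_ge0 // ler_nat.
apply/subset_leq_card/fintype.subsetP=> A.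
by rewrite !inE => /and3P[-> -> h] /=; exact: le_trans cc' h.
Qed.

Lemma Sset_sharp n (M1 M0 : 'I_n -> bool) (z : {set 'I_n}) :
  (forall i, M1 i = M0 i) -> Sset M1 M0 z = [set i | M1 i].
Proof.
by move=> sharp; apply/finset.setP=> i; rewrite !inE /Mobs -sharp if_same.
Qed.

(** Supplies the order-statistic hypothesis of [rank_stat_dominated]. *)
Lemma vvec_dominated (R : realType) n (Y1 Y0 : 'I_n -> R)
    (M1 M0 : 'I_n -> bool) (z : {set 'I_n}) (k : nat) (c : R) (i : 'I_n) :
  Hto Y1 Y0 M1 M0 z k c ->
  (rank_in (key (fun j => (Y0 j)%:E)) (Tset M1 M0 z) i <=
   #|[set j in Tset M1 M0 z | (key (vvec Y1 Y0 M1 M0 z k c) j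
                                <= key (fun j => (Y0 j)%:E) i)%O]|)%N.
Proof.
rewrite /Hto /nS1; set T := Tset M1 M0 z; set K := [set j in T | _] => HK.
set x := key _ i.
have km : (k <= #|T|)%N by apply: leq_trans HK; rewrite leq_addr.
(* At most [#|T| - k] treated units outside [W] have [tau > c], whereas
   [vvec] sends to -oo exactly the [#|T| - k] largest outcomes; as [W] is a
   down-set of outcomes, the latter loses nothing to overlap unless it already
   covers [T]. *)
pose yc j := (Yobs Y1 Y0 z j - c)%:E.
pose yo j := (Yobs Y1 Y0 z j)%:E.
pose W := [set j in T | (key yc j <= x)%O].
have zT j : j \in T -> j \in z by rewrite !inE => /andP[].
(* If [tau j <= c] then [Y1 j - c <= Y0 j], which puts [j] in [W]; otherwise [j] is in [K]. *)
have subL : [set j in T | (key (fun l => (Y0 l)%:E) j <= x)%O] \subset W :|: K.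
  apply/fintype.subsetP=> j; rewrite !inE => /andP[jT jx]; rewrite jT /=.
  have jz : j \in z by case/andP: jT.
  case: (ltP c (tau Y1 Y0 j)) => [|tc]; rewrite ?orbT ?orbF //.
  apply: le_trans jx; apply: key_le; rewrite /= /yc /Yobs jz lee_fin.
  by rewrite lerBlDr addrC -lerBlDr.
pose J := [set j in T | (k < rank_in (key yo) T j)%N].
(* With [L = #|T| - k] the cutoff [#|T| - L] is exactly [k], because [k <= #|T|]. *)
have JE : Jset Y1 Y0 M1 M0 z (#|T| - k) = J.
  apply/finset.setP=> j; rewrite !inE /nS1 -/T subKn //; congr (_ && (_ < _)%N).
  by apply: eq_card => l; rewrite !inE (psi_key yo yo).
have subR : W :|: J \subset
    [set j in T | (key (vvec Y1 Y0 M1 M0 z k c) j <= x)%O].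
  apply/fintype.subsetP=> j jWJ.
  have jT : j \in T by move: jWJ; rewrite !inE => /orP[] /andP[].
  rewrite inE jT /= /key lexi_pair /vvec /nS1 -/T JE.
  case: ifP => [_|jJ]; first by rewrite leNye /=.
  move: jWJ; rewrite inE jJ orbF inE jT /= /key lexi_pair /yc.
  by rewrite zT.
(* Subtracting the same [c] from all treated outcomes keeps their order, ties included. *)
have Wd : {in T & W, forall i j, (key yo i <= key yo j)%O -> i \in W}.
  move=> j l jT; rewrite [l \in W]inE [j \in W]inE jT => /andP[_ lx] jl /=.
  apply: le_trans lx; move: jl; rewrite -!psi_key /psi /yc /yo.
  by rewrite !lte_fin !eqe ltrD2r (inj_eq (addIr _)).
have WT : W \subset T by apply/fintype.subsetP=> j; rewrite inE => /andP[].
apply: leq_trans (subset_leq_card subR).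
apply: leq_trans (card_downset_top k WT Wd).
rewrite leq_min rank_in_max /=.
apply: leq_trans (subset_leq_card subL) _; rewrite cardsU.
apply: leq_trans (leq_subr _ _) _; rewrite leq_add2l leq_subRL //.
Qed.

Lemma control_vvec (R : realType) n (Y1 Y0 : 'I_n -> R)
    (M1 M0 : 'I_n -> bool) (z : {set 'I_n}) (k : nat) (c : R) (i : 'I_n) :
  i \notin z -> vvec Y1 Y0 M1 M0 z k c i = (Y0 i)%:E.
Proof.
by move=> iz; rewrite /vvec !inE /Yobs (negbTE iz) !andbF subr0.
Qed.

Lemma Gfun_le_pval (R : realType) n (Y1 Y0 : 'I_n -> R)
    (M1 M0 : 'I_n -> bool) (b : bool) (phi : nat -> R) (y0 : 'I_n -> R)
    (z : {set 'I_n}) (k : nat) (c : R) :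
  {homo phi : a b / (a <= b)%N >-> a <= b} ->
  Hto Y1 Y0 M1 M0 z k c ->
  Gfun b phi (Sset M1 M0 z) (nS1 M1 M0 z) y0
    (tstat b phi (Sset M1 M0 z) z (fun i => (Y0 i)%:E))
  <= pval Y1 Y0 M1 M0 b phi y0 z k c.
Proof.
move=> phi_mono H; apply: Gfun_anti; rewrite !tstat_key.
apply: rank_stat_dominated => //; try exact: key_inj.
  by move=> i; rewrite inE => /andP[iz _]; rewrite /key control_vvec.
by move=> i _; exact: vvec_dominated.
Qed.

(** The coordinates sent to -oo do not depend on [c]; raising [c] lowers the other treated ones and
    leaves controls alone. *)
Lemma pval_mono (R : realType) n (Y1 Y0 : 'I_n -> R)
    (M1 M0 : 'I_n -> bool) (b : bool) (phi : nat -> R) (y0 : 'I_n -> R)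
    (z : {set 'I_n}) (k : nat) :
  {homo phi : a b / (a <= b)%N >-> a <= b} ->
  {homo pval Y1 Y0 M1 M0 b phi y0 z k : c c' / c <= c'}.
Proof.
move=> phi_mono c c' cc'; apply: Gfun_anti; rewrite !tstat_key.
apply: rank_stat_dominated => //; try exact: key_inj.
  by move=> i; rewrite inE => /andP[iz _]; rewrite /key !control_vvec.
move=> i iT; apply/subset_leq_card/fintype.subsetP=> j.
rewrite !inE => /andP[jT]; rewrite jT; apply: le_trans.
apply: key_le; rewrite /vvec.
case: ifP => // _; rewrite lee_fin lerD2l lerN2.
by case: ifP.
Qed.

(** * Validity of the oracle p-value *)

Lemma Gfun_valid (R : realType) n (n1 : nat) (b : bool) (phi : nat -> R)
    (S : {set 'I_n}) (y0 : 'I_n -> R) (y : 'I_n -> \bar R) (a : R) :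
  (n1 <= n)%N -> 0 <= a ->
  cre_prob R n1 (fun z => Gfun b phi S #|S :&: z| y0 (tstat b phi S z y) <= a)
    <= a.
Proof.
move=> n1n a0; rewrite /cre_prob ler_pdivrMr; last by rewrite ltr0n bin_gt0.
have <- : #|[set z : {set 'I_n} | #|z| == n1]| = 'C(n, n1).
  by rewrite card_draws card_ord.
set E := [set z | _]; set O := [set z | _].
rewrite -[#|E|]sum1_card -[#|O|]sum1_card.
(* Given [z :\: S = w], the set [S :&: z] is uniform over the subsets of [S]
   of cardinal [n1 - #|w|]. *)
rewrite (partition_big (fun z => z :\: S) predT) //=.
rewrite [X in _ <= a * X%:R](partition_big (fun z => z :\: S) predT) //=.
rewrite !natr_sum mulr_sumr; apply: ler_sum => w _.
rewrite !sum1dep_card.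
set Ew := [set z | _]; set Ow := [set z | _].
(* The witness [z0] ensures that [w] is disjoint from [S] and that [#|w| <= n1]. *)
have [->|[z0]] := set_0Vmem Ew; first by rewrite cards0 mulr_ge0.
rewrite !inE => /andP[/andP[/eqP z0n _] /eqP z0w].
pose m := (n1 - #|w|)%N.
have wS : S :&: w = finset.set0.
  by rewrite -z0w finset.setIDA finset.setIC finset.setDIl finset.setDv
    finset.setI0.
pose Om := [set A in powerset S | #|A| == m].
have cOm : #|Om| = 'C(#|S|, m).
  by rewrite -cards_draws; apply: eq_card => A; rewrite !inE.
have cI z : z \in O -> z :\: S = w -> #|S :&: z| = m.
  by rewrite inE /m => /eqP <- <-; rewrite -(cardsID S z) addnK finset.setIC.
have OmOw : (#|Om| <= #|Ow|)%N.
  rewrite -(card_in_imset (f := fun A => A :|: w)).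
    apply/subset_leq_card/fintype.subsetP=> _ /imsetP[A + ->].
    rewrite !inE => /andP[AS /eqP cA].
    have Aw : A :&: w = finset.set0.
      by apply/eqP; rewrite -finset.subset0 -wS finset.setSI.
    rewrite cardsU Aw cards0 subn0 cA /m subnK ?eqxx /=; last first.
      by rewrite -z0n -z0w subset_leq_card // finset.subsetDl.
    rewrite finset.setDUl (_ : A :\: S = finset.set0) ?finset.set0U; last first.
      by apply/eqP; rewrite finset.setD_eq0.
    by apply/eqP/finset.setDidPl; rewrite -finset.setI_eq0 finset.setIC wS.
  move=> A B; rewrite !inE => /andP[AS _] /andP[BS _] /(congr1 (finset.setI S)).
  rewrite !finset.setIUr wS !finset.setU0.
  by rewrite (finset.setIidPr AS) (finset.setIidPr BS).
pose tA (A : {set 'I_n}) := rank_stat b phi S A (key y).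
(* Intersecting with [S] is injective where [z :\: S = w]. Distribution freeness trades [y0] for
   [y], turning the p-value into an upper-tail proportion over [Om]. *)
have EwOm : (#|Ew| <= #|[set A in Om |
    (#|[set B in Om | (tA A <= tA B)%R]|%:R / #|Om|%:R <= a)%R]|)%N.
  rewrite -(card_in_imset (f := fun z => S :&: z)).
    apply/subset_leq_card/fintype.subsetP=> _ /imsetP[z + ->].
    rewrite !inE => /andP[/andP[zn Gz] /eqP zw].
    have cz : #|S :&: z| = m by apply: cI => //; rewrite inE.
    rewrite finset.subsetIl cz eqxx /=; apply: le_trans Gz.
    rewrite /Gfun cz cOm ler_wpM2r ?invr_ge0 // ler_nat /tA rank_stat_setI.
    rewrite tstat_key.
    have := card_subsets_rank_stat_ge b phi S m (rank_stat b phi S z (key y))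
      (@key_inj _ _ (fun i => (y0 i)%:E)) (@key_inj _ _ y).
    move=> h; apply: leq_trans (leq_trans _ h) _; apply/eq_leq/eq_card=> A.
      by rewrite !inE andbA.
    by rewrite !inE tstat_key.
  move=> z z'; rewrite inE => /andP[_ /eqP zw].
  rewrite inE => /andP[_ /eqP z'w] zz'.
  by rewrite -(finset.setID z S) -(finset.setID z' S) zw z'w
    finset.setIC zz' finset.setIC.
apply: le_trans (le_trans _ (card_upper_tail_le Om tA a0)) _.
  by rewrite ler_nat.
by rewrite ler_wpM2l // ler_nat.
Qed.

(** * From p-values to prediction intervals *)

Lemma cre_prob_sub (R : realType) n (n1 : nat) (E F : {set 'I_n} -> bool) :
  (forall z, E z -> F z) -> cre_prob R n1 E <= cre_prob R n1 F.
Proof.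
move=> EF; rewrite ler_wpM2r ?invr_ge0 // ler_nat.
apply/subset_leq_card/fintype.subsetP=> z.
by rewrite !inE => /andP[-> /EF ->].
Qed.

Lemma cre_prob_cover (R : realType) n (n1 : nat) (E F : {set 'I_n} -> bool) :
  (n1 <= n)%N -> (forall z, E z || F z) ->
  1 - cre_prob R n1 F <= cre_prob R n1 E.
Proof.
move=> n1n EF; rewrite lerBlDr -mulrDl ler_pdivlMr ?ltr0n ?bin_gt0 //.
rewrite mul1r -natrD ler_nat -[X in 'C(X, _)](card_ord n) -card_draws.
rewrite -cardsUI (leq_trans _ (leq_addr _ _)) //.
apply/subset_leq_card/fintype.subsetP=> z.
by rewrite !inE -andb_orr EF andbT.
Qed.

(** The threshold, at index [k.-1], is the last entry of [take k s], so only the entries after it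
    can exceed it. *)
Lemma Hto_tau_to (R : realType) n (Y1 Y0 : 'I_n -> R)
    (M1 M0 : 'I_n -> bool) (z : {set 'I_n}) (k : nat) :
  (0 < k <= nS1 M1 M0 z)%N ->
  Hto Y1 Y0 M1 M0 z k (tau_to Y1 Y0 M1 M0 z k).
Proof.
rewrite /Hto /tau_to /nS1; set T := Tset M1 M0 z.
set s := sort _ _; set c := nth _ _ _ => /andP[k0 kT].
have ss : size s = #|T| by rewrite size_sort size_map -cardE.
have -> : #|[set i in T | c < tau Y1 Y0 i]| = count (fun x => c < x) s.
  rewrite count_sort count_map -size_filter cardE /enum_mem -filter_predI.
  congr size; apply: eq_filter => i.
  by rewrite -[LHS]/(i \in [set i in T | c < tau Y1 Y0 i]) inE /= andbC.
rewrite -[X in count _ X](cat_take_drop k) count_cat.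
have -> : count (fun x => c < x) (take k s) = 0%N.
  apply/eqP; rewrite -leqn0 leqNgt -has_count; apply/hasPn=> x.
  move=> /(nthP 0)[l]; rewrite size_takel ?ss // => lk <-.
  rewrite nth_take // -leNgt.
  apply: (sorted_leq_nth le_trans le_refl) => //.
  - exact: sort_le_sorted.
  - by rewrite inE ss (leq_trans lk).
  - by rewrite inE ss prednK.
  - by rewrite -ltnS prednK.
rewrite add0n -ss -[leqRHS](subnKC (_ : k <= size s)%N) ?ss //.
by rewrite leq_add2l -ss -size_drop count_size.
Qed.

(** The ray is closed exactly when the infimum is attained. The extended infimum also covers the
    empty set and the whole line, both in the strict form. *)
Lemma up_closed_ray (R : realType) (I : set R) :
  (forall c c', c <= c' -> I c -> I c') ->
  let l := ereal_inf [set c%:E | c in I]%classic in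
  (forall c : R, I c <-> (l <= c%:E)%E) \/ (forall c : R, I c <-> (l < c%:E)%E).
Proof.
move=> up l.
have lb c : I c -> (l <= c%:E)%E.
  by move=> Ic; apply: ereal_inf_lbound; exists c.
have above c : (l < c%:E)%E -> I c.
  by move=> /ereal_inf_lt[_ [c' Ic' <-]]; rewrite lte_fin => /ltW/up; apply.
have [[c0 Ic0 lc0]|ninf] := pselect (exists2 c0, I c0 & l = c0%:E).
  by left=> c; split=> [/lb //|]; rewrite lc0 lee_fin => /up; apply.
right=> c; split=> [Ic|/above //]; rewrite lt_neqAle lb // andbT.
by apply/eqP=> lc; apply: ninf; exists c.
Qed.

Theorem theorem9 (R : realType) (n n1 : nat) (Hn1 : (0 < n1)%N) (Hn0 : (n1 < n)%N)
    (Y1 Y0 : 'I_n -> R) (M1 M0 : 'I_n -> bool)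
    (choice : bool) (phi : nat -> R) (phi_mono : {homo phi : a b / (a <= b)%N >-> a <= b})
    (y0 : 'I_n -> R)
    (sharp : forall i, M1 i = M0 i) :
  (* (i) validity of the p-value *)
  (forall (k : nat) (c alpha : R), (1 <= k)%N -> 0 < alpha < 1 ->
     cre_prob R n1 (fun z => (pval Y1 Y0 M1 M0 choice phi y0 z k c <= alpha)
                           && Hto Y1 Y0 M1 M0 z k c) <= alpha)
  /\
  (* (ii) prediction interval for each tau_{to(k)} *)
  (forall (k : nat) (alpha : R), (1 <= k)%N -> 0 < alpha < 1 ->
     1 - alpha <= cre_prob R n1 (fun z => (k <= nS1 M1 M0 z)%N ==>
        `[< Ito Y1 Y0 M1 M0 choice phi y0 alpha z k (tau_to Y1 Y0 M1 M0 z k) >])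
     /\
     (forall z : {set 'I_n}, #|z| = n1 -> (k <= nS1 M1 M0 z)%N ->
        let I := Ito Y1 Y0 M1 M0 choice phi y0 alpha z k in
        let that := ereal_inf [set c%:E | c in I] in
        (forall c : R, I c <-> (that <= c%:E)%E) \/
        (forall c : R, I c <-> (that < c%:E)%E)))
  /\
  (* (iii) simultaneous validity *)
  (forall alpha : R, 0 < alpha < 1 ->
     1 - alpha <= cre_prob R n1 (fun z =>
       [forall k : 'I_(n.+1), ((1 <= k)%N && (k <= nS1 M1 M0 z)%N) ==>
          `[< Ito Y1 Y0 M1 M0 choice phi y0 alpha z k
                 (tau_to Y1 Y0 M1 M0 z k) >]])).
Proof.
set S := [set i | M1 i].
pose oracle z := Gfun choice phi S #|S :&: z| y0
                   (tstat choice phi S z (fun i => (Y0 i)%:E)).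
have le_pval z k c : Hto Y1 Y0 M1 M0 z k c ->
    oracle z <= pval Y1 Y0 M1 M0 choice phi y0 z k c.
  move=> H; have := Gfun_le_pval choice y0 phi_mono H.
  by rewrite /nS1 /Tset Sset_sharp.
have valid a : 0 < a < 1 -> cre_prob R n1 (fun z => oracle z <= a) <= a.
  by move=> /andP[a0 _]; exact: Gfun_valid (ltnW Hn0) (ltW a0).
have simul a : 0 < a < 1 -> 1 - a <= cre_prob R n1 (fun z =>
    [forall k : 'I_(n.+1), ((1 <= k)%N && (k <= nS1 M1 M0 z)%N) ==>
      `[< Ito Y1 Y0 M1 M0 choice phi y0 a z k (tau_to Y1 Y0 M1 M0 z k) >]]).
  move=> a01.
  apply: (@le_trans _ _ (1 - cre_prob R n1 (fun z => oracle z <= a))).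
    by rewrite lerD2l lerN2 valid.
  apply: cre_prob_cover => [|z]; first exact: ltnW.
  rewrite orbC; case: (leP (oracle z) a) => //= az.
  (* The hypothesis [Hto] always holds at [c = tau_to k], so there the p-value is at least the
     oracle. *)
  apply/forallP=> k; apply/implyP=> /Hto_tau_to H; apply/asboolP.
  exact: lt_le_trans az (le_pval _ _ _ (H _ _ _)).
split; [|split=> //] => [k c a k1 a01|k a k1 a01].
  apply: le_trans (valid a a01); apply: cre_prob_sub => z /andP[pa /le_pval].
  by move=> op; exact: le_trans op pa.
split=> [|z _ _].
  (* Marginal coverage is one instance of the simultaneous one; [k <= nS1 <= n] makes [k] a valid
     ordinal. *)
  apply: le_trans (simul a a01) _; apply: cre_prob_sub => z /forallP H.
  apply/implyP=> kz; have kn : (k < n.+1)%N.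
    by rewrite ltnS (leq_trans kz) // -[leqRHS]card_ord max_card.
  by have /implyP := H (Ordinal kn); apply; rewrite k1.
apply: up_closed_ray => c c' cc'; rewrite /Ito /= => /lt_le_trans; apply.
exact: pval_mono.
Qed.
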